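(* Let $m\ge 1$ be an integer, let $N_1<N_2$ be integers, and let $E\subset[N_1,N_2]$ be a (finite) sequence of distinct numbers. Then $E$ is an almost phaseless sampling sequence for $V_m|_{[N_1,N_2]}$ if and only if it satisfies all of the following conditions: $$\#E \ge N_2-N_1+m+1,$$ $$\#\big(E \cap [N_1, N_1+k)\big) \ge k+1 \quad\text{for all integers } 1\le k\le N_2-N_1,$$ $$\#\big(E \cap (N_2-k, N_2]\big) \ge k+1 \quad\text{for all integers } 1\le k\le N_2-N_1,$$ $$\#\big(E \cap (n_1, n_2)\big) \ge n_2-n_1-m+1 \quad\text{for all integers } N_1\le n_1 < n_2 \le N_2.$$
   Context: For an integer $m\ge 1$, $\varphi_m=\chi_{[0,1]}*\cdots*\chi_{[0,1]}$ ($m+1$ factors) is the B-spline of degree $m$ (supported on $[0,m+1]$), and $V_m=\{\sum_{n\in\mathbb Z}c_n\varphi_m(\cdot-n): c_n\in\mathbb R\}$. For integers $N_1<N_2$, $V_m|_{[N_1,N_2]}$ is the space of functions $g\cdot\chi_{[N_1,N_2]}$ with $g\in V_m$; it has dimension $N_2-N_1+m$, with basis the restrictions to $[N_1,N_2]$ of $\varphi_m(\cdot-n)$, $N_1-m\le n\le N_2-1$. A sequence of distinct points $E=\{x_i:1\le i\le N\}\subset[N_1,N_2]$ is an almost phaseless sampling sequence for $V_m|_{[N_1,N_2]}$ if there is a set $H_0\subset V_m|_{[N_1,N_2]}$ which is a union of finitely many proper linear subspaces such that every $f\in V_m|_{[N_1,N_2]}\setminus H_0$ is determined up to a sign by $\{|f(x_i)|:1\le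 i\le N\}$, i.e. if $g\in V_m|_{[N_1,N_2]}$ and $|g(x_i)|=|f(x_i)|$ for all $i$, then $g=f$ or $g=-f$. $\#E$ denotes the cardinality of $E$. *)

(* Defs.v *)
From HB Require Import structures.
From mathcomp Require Import all_boot all_order all_algebra.
From mathcomp Require Import all_classical all_reals all_analysis.

Set Implicit Arguments.
Unset Strict Implicit.
Unset Printing Implicit Defensive.

Import Order.TTheory GRing.Theory Num.Theory.
Import numFieldNormedType.Exports.

Local Open Scope classical_set_scope.
Local Open Scope ring_scope.

Definition convolution (R : realType) (f g : R -> R) : R -> R :=
  fun x => \int[@lebesgue_measure R]_t (f t * g (x - t)).

(* [bspline R m] is the convolution of [m.+1] copies of the indicator of [0, 1]. *)
Fixpoint bspline {R : realType} (m : nat) : R -> R :=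
  if m is m'.+1 then convolution (bspline m') \1_`[0, 1] else \1_`[0, 1].

(* The sum over the integers is a finitely supported sum: for each [x] only
   finitely many [n] contribute, the B-spline being compactly supported. *)
Definition spline_space (R : realType) (m : nat) : set (R -> R) :=
  [set g | exists c : int -> R,
     g = fun x => \sum_(n \in [set: int]) c n * bspline m (x - n%:~R)].

Definition spline_space_on (R : realType) (m : nat) (N1 N2 : int) :
    set (R -> R) :=
  [set g \* \1_`[N1%:~R, N2%:~R] | g in spline_space m].

(* The codomain [R^o] selects the structure of [R] as a vector space over
   itself. *)
Definition linear_subspace (R : realType) (W : set (R -> R)) : Prop :=
  submod_closed (mem (W : set (R -> R^o))).

Definition determined_up_to_sign (R : realType) (V : set (R -> R)) (E : seq R)
    (f : R -> R) : Prop :=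
  forall g, V g -> (forall x, x \in E -> `|g x| = `|f x|) -> g = f \/ g = - f.

Definition almost_phaseless_sampling (R : realType) (V : set (R -> R))
    (E : seq R) : Prop :=
  exists H0 : set (R -> R),
    (exists (k : nat) (W : 'I_k -> set (R -> R)),
       (forall i, linear_subspace (W i) /\ W i `<` V) /\
       H0 = \bigcup_(i in [set: 'I_k]) W i) /\
    forall f, (V `\` H0) f -> determined_up_to_sign V E f.

(* Main.v *)
Require Import Defs.
From mathcomp Require Import all_boot all_order all_algebra.
From mathcomp Require Import all_classical all_reals all_analysis.
From mathcomp Require Import zify lra.

Set Implicit Arguments.
Unset Strict Implicit.
Unset Printing Implicit Defensive.

Import Order.TTheory GRing.Theory Num.Theory.
Import numFieldNormedType.Exports.

Local Open Scope classical_set_scope.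
Local Open Scope ring_scope.

(** The space V of splines restricted to [N1, N2] has dimension
    d = N2 - N1 + m, and whether almost all of its members are determined up to
    sign by their moduli on E is a question about the linear matroid of the
    point evaluations.

    If |g| = |f| on E and S is the set of points where g = f, then
    f = (f - g)/2 + (f + g)/2 with the first term vanishing on S and the second
    one on E \ S.  So the ambiguous f lie in finitely many subspaces
    V_S + V_(E \ S), where V_T consists of the members of V vanishing on T.
    Removing the proper ones among them is harmless, and hence E works exactly
    when V_E = 0 and V_S + V_(E \ S) = V forces S to be trivial: the evaluations
    on E span the dual of V and form a connected matroid
    ([almost_phaseless_of_connected], [almost_phaseless_inj],
    [almost_phaseless_connected]).

    The matroid is known through the Schoenberg-Whitney theorem
    ([schoenberg_whitney]): d increasing points, the j-th one inside the support
    of the j-th B-spline, determine a spline.  It is proved by induction on the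
    degree.  If some node but the first lies in the last knot interval of its
    window, or some node but the last in the first one, the linear system is
    block triangular and splits; otherwise the zeros which Rolle's theorem yields
    for the derivative lie again in the windows of the B-splines of one degree
    less.

    The four counting conditions are a Hall condition.  They are what is needed
    to pick d + 1 increasing points y_0 < ... < y_d of E any d of which satisfy
    the Schoenberg-Whitney condition ([select_nodes], [hall_condition]).
    Exchanging a point of E for a neighbouring y_a preserves that condition
    ([exchange]), so all points of E lie in the same component of the matroid.

    Conversely, for any 0 < k < d consecutive B-splines, more than k points of E
    lie in the union of their supports, for otherwise interpolation by these
    B-splines decomposes V ([block_count]); the left, right and inner conditions
    are the cases of the first B-splines, the last ones, and those supported in
    [n1, n2].  When n2 - n1 = m no B-spline is supported in [n1, n2], but an
    empty (n1, n2) separates the B-splines seen on its left from those seen on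
    its right ([gap_count]). *)

(** * B-splines *)

Section Bspline.
Variable R : realType.
Notation mu := (@lebesgue_measure R).
Implicit Types (m : nat) (x : R).

Lemma bspline_int m x :
  bspline m.+1 x = \int[mu]_(t in `[x - 1, x]) bspline m t.
Proof.
rewrite /= /convolution [RHS]Rintegral_mkcond; apply: eq_Rintegral => t _.
rewrite patchE indicE.
have -> : (x - t \in `[0, 1]%classic) = (t \in `[x - 1, x]%classic).
  by apply/idP/idP; rewrite !inE /= !in_itv /= => /andP[? ?]; apply/andP; split; lra.
by case: ifP; rewrite ?mulr1 ?mulr0.
Qed.

Lemma bspline_ge0 m x : 0 <= bspline m x.
Proof.
elim: m x => [|m IH] x; first by rewrite /= indicE.
by rewrite bspline_int; apply: Rintegral_ge0.
Qed.

Lemma bspline1E : bspline 1 = (fun x : R => Num.max 0 (1 - `|x - 1|)).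
Proof.
apply/funext => x; rewrite bspline_int /= /Rintegral integral_indic //=.
have -> : `[0, 1]%classic `&` `[x - 1, x]%classic =
    `[Num.max 0 (x - 1), Num.min 1 x]%classic :> set R.
  apply/seteqP; split => t /=; rewrite !in_itv /= ge_max le_min; first by lra.
  by lra.
rewrite lebesgue_measure_itv /= lte_fin lt_min !gt_max.
case: ifPn => [|h].
  rewrite -EFinB /= => /andP[/andP[_ ?] /andP[? ?]].
  case: (leP x 1) => ?.
    by rewrite ler0_norm ?(max_l (_ : x - 1 <= 0)) ?max_r //; lra.
  by rewrite gtr0_norm ?(max_r (_ : 0 <= x - 1)) ?max_r //; lra.
symmetry; apply: max_l; rewrite subr_le0; move: h; rewrite !negb_and ltr01 /= -!leNgt.
rewrite ler_normr; lra.
Qed.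

Lemma bspline1_up x : 0 <= x <= 1 -> bspline 1 x = x.
Proof. by move=> ?; rewrite bspline1E ler0_norm ?max_r //; lra. Qed.

Lemma bspline1_down x : 1 <= x <= 2 -> bspline 1 x = 2 - x.
Proof. by move=> ?; rewrite bspline1E ger0_norm ?max_r //; lra. Qed.

(** The induction starts in degree 1, since in degree 0 the endpoints 0 and 1
    belong to the support. *)
Lemma bspline_out m x : (0 < m)%N -> (x <= 0) || (m.+1%:R <= x) -> bspline m x = 0.
Proof.
case: m => // m _; elim: m x => [|m IH] x xout.
  rewrite bspline1E; apply: max_l; rewrite subr_le0 ler_normr.
  by move: xout; rewrite -natr1; lra.
rewrite bspline_int (_ : \int[mu]_(t in _) _ = \int[mu]_(t in `[x - 1, x]) cst 0 t).
  by rewrite Rintegral_cst ?mul0r.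
apply: eq_Rintegral => t; rewrite inE /= in_itv /= => t_x; apply: IH.
by move: xout t_x; rewrite -!natr1; lra.
Qed.

Let F m x := \int[mu]_(t in `]-oo, x]) bspline m t.

Let bspline_prim m x : mu.-integrable setT (EFin \o bspline m) ->
  bspline m.+1 x = F m x - F m (x - 1).
Proof.
move=> intf; rewrite /F (@Rintegral_itvB _ _ -oo%O (BRight x)) ?bnd_simp //; last 2 first.
  by apply: integrableS intf.
  lra.
rewrite bspline_int Rintegral_itv_obnd_cbnd //.
by apply: integrableS intf.
Qed.

Let bspline_integrable m : (0 < m)%N -> continuous (bspline m : R -> R) ->
  mu.-integrable setT (EFin \o bspline m).
Proof.
move=> m0 cf.
have -> : EFin \o bspline m = (EFin \o bspline m) \_ `[0, m.+1%:R : R].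
  apply/funext => x; rewrite patchE; case: ifPn => //.
  rewrite notin_setE /= in_itv /= => /negP xout; rewrite bspline_out //.
  by move: xout; rewrite negb_and -!ltNge => /orP[] /ltW ->; rewrite ?orbT.
apply: (iffLR (integrable_mkcond _ _)) => //.
apply: (@continuous_compact_integrable R (bspline m) `[0, m.+1%:R]).
  exact: segment_compact.
exact: continuous_subspaceT.
Qed.

(** Primitives are taken from -oo, so that they are differentiable at every
    point by the fundamental theorem of calculus. *)
Let is_derive_prim m x : (0 < m)%N -> continuous (bspline m : R -> R) ->
  is_derive x 1 (F m) (bspline m x).
Proof.
move=> m0 cf.
have [|||d <-] := @continuous_FTC1 R (bspline m) -oo%O x (x + 1) _ _ _ (cf x).
- lra.
- by apply: integrableS (bspline_integrable m0 cf).
- by rewrite ltNyr.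
by rewrite derive1E; exact/derivableP.
Qed.

Let bspline_deriv_of m x : (0 < m)%N -> continuous (bspline m : R -> R) ->
  is_derive x 1 (bspline m.+1 : R -> R) (bspline m x - bspline m (x - 1)).
Proof.
move=> m0 cf.
have -> : bspline m.+1 = F m - (F m \o (fun t => t - 1)) :> (R -> R).
  by apply/funext => t; rewrite bspline_prim //; exact: bspline_integrable.
apply: is_deriveB; first exact: is_derive_prim.
rewrite -[X in is_derive _ _ _ X]mulr1.
apply: is_derive1_comp; first exact: is_derive_prim.
by rewrite -[X in is_derive _ _ _ X]subr0; exact: is_deriveB.
Qed.

Lemma bspline_continuous m : (0 < m)%N -> continuous (bspline m : R -> R).
Proof.
case: m => // m _; elim: m => [|m IH].
  rewrite bspline1E => x.
  apply: (@continuous_max R R (cst 0) (fun t => 1 - `|t - 1|)); first exact: cst_continuous.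
  apply: (@continuousB R R R (cst 1) (fun t => `|t - 1|)); first exact: cst_continuous.
  apply: (@continuous_comp _ _ _ (fun t : R => t - 1) (fun t => `|t|)).
    by apply: (@continuousB R R R id (cst 1)) => //; exact: cst_continuous.
  exact: norm_continuous.
move=> x; apply: differentiable_continuous; apply/derivable1_diffP.
by have [] := bspline_deriv_of x (ltn0Sn m) IH.
Qed.

Lemma is_derive_bspline m x : (0 < m)%N ->
  is_derive x 1 (bspline m.+1 : R -> R) (bspline m x - bspline m (x - 1)).
Proof. by move=> m0; apply: bspline_deriv_of => //; exact: bspline_continuous. Qed.

(** The increment of a primitive over [x - 1, x] is at least its increment over
    the part [p, q] of [x - 1, x] inside the support, where the mean value
    theorem makes it positive. *)
Lemma bspline_gt0 m x : (0 < m)%N -> 0 < x < m.+1%:R -> 0 < bspline m x.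
Proof.
case: m => // m _; elim: m x => [|m IH] x xin.
  rewrite bspline1E lt_max subr_gt0 ltr_norml; apply/orP; right.
  by move: xin; lra.
have cf := @bspline_continuous m.+1 (ltn0Sn m).
have dF y := is_derive_prim y (ltn0Sn m) cf.
have contF : continuous (F m.+1).
  by move=> y; apply: differentiable_continuous; apply/derivable1_diffP; case: (dF y).
rewrite bspline_prim; last exact: bspline_integrable.
have F_le a b : a <= b -> F m.+1 a <= F m.+1 b.
  move=> ab; rewrite -subr_ge0.
  have [//||c _ ->] := @MVT_segment R (F m.+1) (bspline m.+1) a b.
    exact: continuous_subspaceT.
  by rewrite mulr_ge0 ?subr_ge0 ?bspline_ge0.
pose p := Num.max 0 (x - 1); pose q := Num.min x m.+2%:R.
have pq : p < q.
  rewrite /p /q lt_min !gt_max; move: xin (ler0n R m); rewrite -!natr1.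
  lra.
have [|c] := @MVT R (F m.+1) (bspline m.+1) p q pq.
  exact: continuous_subspaceT.
rewrite in_itv /= /p /q gt_max lt_min => c_in Fpq.
have := F_le (x - 1) p; have := F_le q x.
rewrite {1}/q {2}/p ge_min lexx le_max lexx orbT => /(_ isT) + /(_ isT).
have : 0 < bspline m.+1 c * (q - p).
  by rewrite mulr_gt0 ?subr_gt0 // IH //; move: c_in; lra.
rewrite -Fpq; lra.
Qed.
End Bspline.

(** * The Schoenberg-Whitney theorem *)

Section SchoenbergWhitney.
Variable R : realType.
Implicit Types (m p q : nat) (x : R) (c t : nat -> R).

Definition spline m c p q x : R :=
  \sum_(p <= i < q) c i * bspline m (x - i%:R).

Lemma spline_cat m c p r q x : (p <= r <= q)%N ->
  spline m c p q x = spline m c p r x + spline m c r q x.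
Proof. by case/andP=> pr rq; rewrite /spline (big_cat_nat pr rq). Qed.

Lemma spline_before m c p q x : (0 < m)%N -> x <= p%:R -> spline m c p q x = 0.
Proof.
move=> m0 xp; rewrite /spline big_nat_cond big1 // => i /andP[/andP[pi _] _].
rewrite bspline_out ?mulr0 // subr_le0 (le_trans xp) ?ler_nat //.
Qed.

Lemma spline_after m c p q x : (0 < m)%N -> (q + m)%:R <= x -> spline m c p q x = 0.
Proof.
move=> m0 qx; rewrite /spline big_nat_cond big1 // => i /andP[/andP[_ iq] _].
rewrite bspline_out ?mulr0 // lerBrDl -natrD (le_trans _ qx) ?ler_nat ?orbT //.
by rewrite addnS -addSn leq_add2r.
Qed.

Lemma spline_eq0 m c p q x : (forall i, (p <= i < q)%N -> c i = 0) ->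
  spline m c p q x = 0.
Proof.
move=> c0; rewrite /spline big_nat_cond big1 // => i; rewrite andbT => /c0 ->.
by rewrite mul0r.
Qed.

(** Coefficients of the derivative: backward differences of the coefficients
    extended by zero outside [p, q). *)
Definition spline_delta c p q n : R :=
  (if (n < q)%N then c n else 0) - (if (p < n)%N then c n.-1 else 0).

Lemma is_derive_spline m c p q x : (0 < m)%N -> (p <= q)%N ->
  is_derive x 1 (spline m.+1 c p q) (spline m (spline_delta c p q) p q.+1 x).
Proof.
move=> m0 pq.
have -> : spline m (spline_delta c p q) p q.+1 x =
    \sum_(p <= i < q) c i * (bspline m (x - i%:R) - bspline m (x - i%:R - 1)).
  rewrite /spline /spline_delta; under eq_bigr do rewrite mulrBl.
  rewrite big_split /= sumrN big_nat_recr //= ltnn mul0r addr0.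
  rewrite big_nat_recl //= ltnn mul0r add0r -sumrB.
  apply: eq_big_nat => i /andP[pi iq]; rewrite iq ltnS pi mulrBr; congr (_ - _ * bspline m _).
  by rewrite -natr1; lra.
have -> : spline m.+1 c p q =
    \sum_(p <= i < q) (fun y => c i * bspline m.+1 (y - i%:R)).
  by apply/funext => y; rewrite fct_sumE.
elim/big_rec2: _ => [|i df f _ ddf]; first exact: is_derive_cst.
apply: is_deriveD.
apply: (@is_deriveZ R R R (fun y => bspline m.+1 (y - i%:R)) (c i)).
rewrite -[X in is_derive _ _ _ X]mulr1.
apply: (@is_derive1_comp _ (bspline m.+1) (fun y => y - i%:R)).
  exact: is_derive_bspline.
by rewrite -[X in is_derive _ _ _ X]subr0; exact: is_deriveB.
Qed.

(** The Schoenberg-Whitney condition: increasing points, the i-th one in the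
    interior of the support of the i-th B-spline. *)
Definition nodes m p q t :=
  (forall i, (p <= i < q)%N -> i%:R < t i < (i + m.+1)%:R) /\
  (forall i, (p <= i)%N -> (i.+1 < q)%N -> t i < t i.+1).

Lemma nodes_lt m p q t i j : nodes m p q t -> (p <= i < j)%N -> (j < q)%N ->
  t i < t j.
Proof.
move=> [_ t_mono] /andP[pi]; elim: j => // j IH; rewrite ltnS leq_eqVlt.
move=> /predU1P[<-|ij] jq; first exact: t_mono.
by apply: lt_trans (IH ij (ltnW jq)) (t_mono _ _ jq); rewrite (leq_trans pi) // ltnW.
Qed.

Lemma nodes_sub m p q p' q' t : nodes m p q t -> (p <= p')%N -> (q' <= q)%N ->
  nodes m p' q' t.
Proof.
move=> [tin t_mono] pp qq; split=> i.
  by move=> /andP[? ?]; apply: tin; lia.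
by move=> ? ?; apply: t_mono; lia.
Qed.

Definition unisolvent m p q := forall c t, nodes m p q t ->
  (forall i, (p <= i < q)%N -> spline m c p q (t i) = 0) ->
  forall i, (p <= i < q)%N -> c i = 0.

(** If t r lies to the right of the supports of all B-splines of index less than
    r, then the equations at the nodes from r on involve only the coefficients
    from r on: the system is block triangular.  The other alternative is the
    mirror image. *)
Lemma unisolvent_cat m p r q : (0 < m)%N -> (p <= r <= q)%N ->
  unisolvent m p r -> unisolvent m r q ->
  forall c t, nodes m p q t ->
  ((r < q)%N -> (r + m)%:R <= t r) \/ ((p < r)%N -> t r.-1 <= r%:R) ->
  (forall i, (p <= i < q)%N -> spline m c p q (t i) = 0) ->
  forall i, (p <= i < q)%N -> c i = 0.
Proof.
move=> m0 /andP[pr rq] Hl Hr c t tn tr f0.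
have tnl := nodes_sub tn (leqnn p) rq; have tnr := nodes_sub tn pr (leqnn q).
suff [cl cr] : (forall i, (p <= i < r)%N -> c i = 0) /\
               (forall i, (r <= i < q)%N -> c i = 0).
  by move=> i /andP[pi iq]; case: (ltnP i r) => ir; [apply: cl|apply: cr]; lia.
have f0' i : (p <= i < q)%N -> spline m c p r (t i) + spline m c r q (t i) = 0.
  by move=> /f0; rewrite (@spline_cat m c p r q) // pr rq.
case: tr => tr.
  have cr : forall i, (r <= i < q)%N -> c i = 0.
    apply: (Hr c t) => // i /andP[ri iq].
    rewrite -(f0' i) ?iq ?(leq_trans pr) // (@spline_after m c p r) ?add0r //.
    apply: le_trans (tr (leq_ltn_trans ri iq)) _.
    case: (ltngtP r i) ri => // [ri|->] _; last exact: lexx.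
    by apply/ltW/(nodes_lt tn) => //; lia.
  split => //; apply: (Hl c t) => // i /andP[pi ir].
  rewrite -(f0' i); last by lia.
  by rewrite (spline_eq0 m _ cr) addr0.
have cl : forall i, (p <= i < r)%N -> c i = 0.
  apply: (Hl c t) => // i /andP[pi ir].
  rewrite -(f0' i); last by lia.
  rewrite (@spline_before m c r q) ?addr0 //.
  apply: le_trans (tr (leq_ltn_trans pi ir)).
  have : (i <= r.-1)%N by lia.
  rewrite leq_eqVlt => /predU1P[->|ir']; first exact: lexx.
  by apply/ltW/(nodes_lt tn) => //; lia.
split => //; apply: (Hr c t) => // i /andP[ri iq].
rewrite -(f0' i); last by lia.
by rewrite (spline_eq0 m _ cl) add0r.
Qed.

(** By induction on the number of nodes, only configurations without a block
    triangular splitting remain. *)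
Lemma unisolvent_of_unsplit m : (0 < m)%N ->
  (forall p q c t, (p < q)%N -> nodes m p q t ->
     (forall j, (p < j < q)%N -> j%:R < t j.-1 /\ t j < (j + m)%:R) ->
     (forall i, (p <= i < q)%N -> spline m c p q (t i) = 0) ->
     forall i, (p <= i < q)%N -> c i = 0) ->
  forall p q, unisolvent m p q.
Proof.
move=> m0 H p q; move: {2}(q - p)%N (leqnn (q - p)) => n.
elim: n p q => [|n IH] p q pqn c t tn f0; first by move=> i ?; lia.
have [pq|] := ltnP p q; last by move=> ? i; lia.
have [[r [pr rq tr]]|nosplit] := pselect (exists r, [/\ (p < r)%N, (r < q)%N &
   ((r < q)%N -> (r + m)%:R <= t r) \/ ((p < r)%N -> t r.-1 <= r%:R)]).
  have prq : (p <= r <= q)%N by lia.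
  by apply: (unisolvent_cat m0 prq _ _ tn tr f0); apply: IH; lia.
apply: H pq tn _ f0 => j /andP[pj jq]; split; rewrite ltNge; apply/negP => tj;
  apply: nosplit; exists j; split => //.
  by right.
by left.
Qed.


(** Without a splitting there are at most two nodes, as an inner one would have
    to lie on both sides of the same knot; two nodes lie in one knot interval,
    on which the spline is affine. *)
Lemma unisolvent1 p q : unisolvent 1 p q.
Proof.
move: p q; apply: unisolvent_of_unsplit => // p q c t pq [tin t_mono] tloc f0.
have sum1 x : spline 1 c p p.+1 x = c p * bspline 1 (x - p%:R).
  by rewrite /spline big_nat1.
have pos i : (p <= i < q)%N -> 0 < bspline 1 (t i - i%:R).
  by move=> /tin; rewrite natrD => ?; apply: bspline_gt0 => //; lra.
have [qE|qE] : q = p.+1 \/ q = p.+2.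
- have [|qp] := leqP q p.+2; first by lia.
  have [|_] := tloc p.+1; first by lia.
  have [|/= + _] := tloc p.+2; first by lia.
  by rewrite addn1 => /lt_trans h /h; rewrite ltxx.
- move=> i /andP[pi iq]; have -> : i = p by lia.
  have /f0/eqP : (p <= p < q)%N by lia.
  rewrite qE sum1 mulf_eq0 => /orP[/eqP//|].
  by rewrite gt_eqF // pos // qE !leqnn.
have [|tp tp1] := tloc p.+1; first by lia.
have tpp1 : t p < t p.+1 by apply: t_mono; lia.
rewrite addn1 -!natr1 /= in tp tp1.
have ev x : p%:R + 1 < x < p%:R + 1 + 1 ->
    spline 1 c p q x = c p * (2 - (x - p%:R)) + c p.+1 * (x - p%:R - 1).
  move=> xin; rewrite /spline qE big_ltn; last exact: ltnW.
  rewrite big_nat1 -natr1 (_ : x - (p%:R + 1) = x - p%:R - 1); last by lra.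
  rewrite bspline1_down; last by lra.
  by rewrite bspline1_up //; lra.
have e0 : spline 1 c p q (t p) = 0 by apply: f0; lia.
have e1 : spline 1 c p q (t p.+1) = 0 by apply: f0; lia.
rewrite ev in e0; last by lra.
rewrite ev in e1; last by lra.
have cc : (c p.+1 - c p) * (t p.+1 - t p) = 0 by lra.
have {}cc : c p.+1 = c p.
  apply/eqP; rewrite -subr_eq0; move/eqP: cc; rewrite mulf_eq0 => /orP[//|].
  by rewrite gt_eqF // subr_gt0.
have cp : c p = 0 by move: e0; rewrite cc; lra.
by move=> i /andP[pi iq]; have [->|->] : i = p \/ i = p.+1; [lia| |rewrite cc].
Qed.

(** Consecutive nodes give zeros of the derivative by Rolle's theorem.  The knot
    p, where the spline vanishes, serves as a further node on the left if the
    resulting zero falls into the window of the p-th B-spline of lower degree,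
    which is the case when t p < p + m.+1; otherwise that B-spline is zero at
    all the zeros found and drops out of the system.  The same holds on the
    right.  The induction hypothesis then says that the derivative has zero
    coefficients, so the spline has constant coefficients, and positivity of the
    B-splines makes the constant 0. *)
Lemma unisolvent_succ m p q : (0 < m)%N ->
  (forall p q, unisolvent m p q) -> unisolvent m.+1 p q.
Proof.
move=> m0 IH; move: p q; apply: unisolvent_of_unsplit => // p q c t pq tn tloc f0.
have [tin t_mono] := tn.
set f := spline m.+1 c p q in f0.
pose f' := spline m (spline_delta c p q) p q.+1.
have df x : is_derive x 1 f (f' x) by apply: is_derive_spline => //; exact: ltnW.
have cf : continuous f.
  by move=> x; apply: differentiable_continuous; apply/derivable1_diffP; case: (df x).
have rolle a b : a < b -> f a = 0 -> f b = 0 -> exists s, [/\ a < s, s < b & f' s = 0].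
  move=> ab fa fb; have [| | |s] := @Rolle R f a b ab.
  - by move=> x _; case: (df x).
  - exact: continuous_subspaceT.
  - by rewrite fa fb.
  rewrite in_itv /= => /andP[a_s s_b] ds; exists s; split => //.
  by rewrite -(@derive_val _ _ _ _ _ _ _ (df s)) (@derive_val _ _ _ _ _ _ _ ds).
(* [al, be) is the range of the derivative B-splines which stay in the system,
     and lo j < hi j are the zeros between which Rolle's theorem is applied. *)
pose al := if t p < (p + m.+1)%:R then p else p.+1.
pose be := if q%:R < t q.-1 then q.+1 else q.
pose lo j := if (j == p)%N then p%:R else t j.-1.
pose hi j := if (j == q)%N then (q + m.+1)%:R else t j.
have /choice[s sP] : forall j, exists s, (al <= j < be)%N ->
    [/\ lo j < s, s < hi j & f' s = 0].
  move=> j; have [jin|jout] := boolP (al <= j < be)%N; last by exists 0.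
  have [lo0 hi0] : f (lo j) = 0 /\ f (hi j) = 0.
    split; rewrite /lo /hi; case: eqP => [_|jE].
    - exact: spline_before.
    - by apply: f0; move: jin; rewrite /al /be; do 2 case: ifP => _; lia.
    - exact: spline_after.
    - by apply: f0; move: jin; rewrite /al /be; do 2 case: ifP => _; lia.
  suff lh : lo j < hi j by have [x] := rolle _ _ lh lo0 hi0; exists x.
  rewrite /lo /hi; case: (j =P p) => [->|jp].
    by rewrite ltn_eqF //; have /andP[] := tin p ltac:(lia).
  have [->|jq] := j =P q.
    have /andP[_] := tin q.-1 ltac:(lia).
    by rewrite (_ : (q.-1 + m.+2 = q + m.+1)%N) //; lia.
  apply: (nodes_lt tn) => //;
    by move: jin; rewrite /al /be; do 2 case: ifP => _; lia.
have als j : (al <= j < be)%N -> t p < (p + m.+1)%:R \/ (p < j)%N.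
  by rewrite /al; case: ifP => [|_]; [left|right; lia].
have bes j : (al <= j < be)%N -> q%:R < t q.-1 \/ (j < q)%N.
  by rewrite /be; case: ifP => [|_]; [left|right; lia].
have pjq j : (al <= j < be)%N -> (p <= j <= q)%N.
  by rewrite /al /be; do 2 case: ifP => _; lia.
have ns : nodes m al be s.
  split=> [j jin|j jl ju].
    have [ls sh _] := sP j jin; have /andP[pj jq] := pjq j jin.
    apply/andP; split.
      apply: le_lt_trans ls; rewrite /lo; case: eqP => [->//|jp].
      have [jE|jq'] := j =P q.
        by have [|] := bes j jin; rewrite jE; [exact: ltW|lia].
      by have [|/ltW//] := tloc j; lia.
    apply: lt_le_trans sh _; rewrite /hi; case: eqP => [->//|jq'].
    have [jE|jp] := j =P p.
      by have [|] := als j jin; rewrite jE; [exact: ltW|lia].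
    by have [|_ /ltW//] := tloc j; lia.
  have [|_ sh _] := sP j; first by lia.
  have [|ls _ _] := sP j.+1; first by lia.
  apply: lt_trans sh _; apply: le_lt_trans ls; rewrite /hi /lo.
  have := pjq j ltac:(lia); have := pjq j.+1 ltac:(lia) => h1 h2.
  by rewrite ltn_eqF ?gtn_eqF //; lia.
have Dl0 j : (al <= j < be)%N -> spline_delta c p q j = 0.
  apply: (IH al be (spline_delta c p q) s ns) => {}j jin.
  have [ls sh fs] := sP j jin; have /andP[pj jq] := pjq j jin.
  have pal : (p <= al <= q.+1)%N by rewrite /al; case: ifP => _; lia.
  have albe : (al <= be <= q.+1)%N by move: jin; rewrite /be; case: ifP => _; lia.
  move: fs; rewrite /f' (spline_cat _ _ _ pal) (spline_cat _ _ _ albe).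
  have -> : spline m (spline_delta c p q) p al (s j) = 0.
    rewrite /al; case: ltP => [_|tp]; first by rewrite /spline big_geq.
    have jp : (p < j)%N by move: jin; rewrite /al ltNge tp /=; lia.
    apply: spline_after => //; rewrite addSnnS; apply: le_trans tp _.
    apply/ltW/(le_lt_trans _ ls); rewrite /lo.
    rewrite gtn_eqF //; have [->//|jp'] := p =P j.-1.
    by apply/ltW/(nodes_lt tn); lia.
  have -> : spline m (spline_delta c p q) be q.+1 (s j) = 0.
    rewrite /be; case: ltP => [_|tq]; first by rewrite /spline big_geq.
    have jq' : (j < q)%N by move: jin; rewrite /be ltNge tq /=; lia.
    apply: spline_before => //; apply: le_trans tq; apply/ltW/(lt_le_trans sh).
    rewrite /hi ltn_eqF //; have [->//|jp'] := j =P q.-1.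
    by apply/ltW/(nodes_lt tn); lia.
  by rewrite add0r addr0.
have cE i : (p <= i < q)%N -> c i = c p.
  elim: i => [|i IHi] /andP[pi iq]; first by have -> : p = 0%N by lia.
  have [->//|pi'] := eqVneq p i.+1.
  rewrite -IHi; last by lia.
  have pi1 : (p < i.+1)%N by lia.
  have : spline_delta c p q i.+1 = 0.
    by apply: Dl0; rewrite /al /be; do 2 case: ifP => _; lia.
  by rewrite /spline_delta iq pi1 => /eqP; rewrite subr_eq0 => /eqP.
have tp := tin p; have fp := f0 p.
suff cp0 : c p = 0 by move=> i /cE ->.
have : c p * \sum_(p <= i < q) bspline m.+1 (t p - i%:R) = 0.
  rewrite mulr_sumr -[RHS](f0 p) ?leqnn ?pq //.
  by apply: eq_big_nat => i /cE ->.
move=> /eqP; rewrite mulf_eq0 => /orP[/eqP//|].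
rewrite gt_eqF // big_ltn // ltr_pwDl //; last by apply: sumr_ge0 => i _; exact: bspline_ge0.
apply: bspline_gt0 => //; move: tp; rewrite leqnn pq natrD => /(_ isT); lra.
Qed.

Lemma schoenberg_whitney m p q : (0 < m)%N -> unisolvent m p q.
Proof.
case: m => // m _; elim: m p q => [|m IH] p q; first exact: unisolvent1.
exact: unisolvent_succ.
Qed.
End SchoenbergWhitney.

(** * Phase retrieval in a space of functions *)

Section Phaseless.
Variable R : realType.
Implicit Types (V W : set (R -> R)) (E : seq R) (f g u w : R -> R) (S : pred R).

Lemma linear_subspaceP W : linear_subspace W <->
  W 0 /\ (forall (a : R) u w, W u -> W w -> W (fun x => a * u x + w x)).
Proof.
split=> -[W0 WD].
  split=> [|a u w Wu Ww]; first by move: W0; rewrite inE.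
  by have := WD a u w (mem_set Wu) (mem_set Ww); rewrite inE.
split; first by rewrite inE.
by move=> a u w /set_mem Wu /set_mem Ww; apply/mem_set/WD.
Qed.

Section Subspace.
Variable V : set (R -> R).
Hypothesis linV : linear_subspace V.

Lemma subspace0 : V 0. Proof. by have [] := (linear_subspaceP V).1 linV. Qed.

Lemma subspaceDZ a u w : V u -> V w -> V (fun x => a * u x + w x).
Proof. by have [_] := (linear_subspaceP V).1 linV; apply. Qed.

Lemma subspaceD u w : V u -> V w -> V (u + w).
Proof.
move=> Vu Vw; have := subspaceDZ 1 Vu Vw.
by congr V; apply/funext => x; rewrite mul1r.
Qed.

Lemma subspaceZ a u : V u -> V (fun x => a * u x).
Proof.
move=> Vu; have := subspaceDZ a Vu subspace0.
by congr V; apply/funext => x; rewrite addr0.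
Qed.

Lemma subspaceN u : V u -> V (- u).
Proof.
move=> Vu; have := subspaceZ (- 1) Vu.
by congr V; apply/funext => x; rewrite mulN1r.
Qed.

Lemma subspaceB u w : V u -> V w -> V (u - w).
Proof. by move=> Vu Vw; apply: subspaceD => //; exact: subspaceN. Qed.

End Subspace.

(** Take a line through a point g outside the new subspace, in a direction f that
    lies in it but in none of the k previous ones.  The new subspace does not
    meet the line and each previous one meets it at most once, so one of k + 1
    points of the line avoids them all. *)
Lemma avoid_subspaces V k (W : 'I_k -> set (R -> R)) : linear_subspace V ->
  (forall i, linear_subspace (W i) /\ W i `<` V) ->
  exists2 f, V f & forall i, ~ W i f.
Proof.
move=> linV; elim: k W => [|k IH] W HW; first by exists 0; [exact: subspace0|case].
have [f Vf fW] := IH (fun i => W (lift ord0 i)) (fun i => HW _).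
have [linW0 [_ WV]] := HW ord0.
have [f0|f0] := pselect (W ord0 f); last first.
  by exists f => // i; have [j ->|->//] := unliftP ord0 i.
have [g Vg gW] : exists2 g, V g & ~ W ord0 g.
  by apply: contra_notP WV => h g Vg; apply: contra_notP h => ?; exists g.
pose h (j : 'I_k.+1) x := (j%:R : R) * f x + g x.
have hW0 j : ~ W ord0 (h j).
  move=> W0h; apply: gW; have := subspaceDZ linW0 (- j%:R) f0 W0h.
  by congr (W ord0); apply/funext => x; rewrite /h addrA -mulrDl addNr mul0r add0r.
have huniq i (j1 j2 : 'I_k.+1) : W (lift ord0 i) (h j1) -> W (lift ord0 i) (h j2) -> j1 = j2.
  move=> W1 W2; apply: contra_notP (fW i) => j12.
  have [linW _] := HW (lift ord0 i).
  have ne : (j1%:R - j2%:R : R) != 0.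
    by rewrite subr_eq0 eqr_nat; apply/negP => /eqP e; apply: j12; exact: val_inj.
  have := subspaceZ linW (j1%:R - j2%:R : R)^-1 (subspaceB linW W1 W2).
  congr (W _); apply/funext => x; rewrite /h /= !fctE.
  by rewrite opprD addrACA subrr addr0 -mulrBl mulrA mulVf // mul1r.
suff [j hj] : exists j, forall i, ~ W (lift ord0 i) (h j).
  exists (h j); first exact: subspaceDZ.
  by move=> i; have [i' ->|->//] := unliftP ord0 i.
apply: contrapT => noj.
have /choice[b bP] : forall j, exists i, W (lift ord0 i) (h j).
  by move=> j; apply: contra_notP noj => ni; exists j => i Wi; apply: ni; exists i.
have /leq_card : injective b by move=> j1 j2 e; apply: (huniq (b j1)); rewrite // e.
by rewrite !card_ord ltnn.
Qed.

Definition vanish (s : seq R) f := forall x, x \in s -> f x = 0.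

(** The sum V_S + V_(E \ S), where V_T is the subspace of the members of V that
    vanish on T. *)
Definition split_sum V E S : set (R -> R) := [set f | exists u w,
  [/\ V u /\ vanish (seq.filter S E) u, V w /\ vanish (seq.filter (predC S) E) w & f = u + w]].

Lemma eq_in_split_sum V E S1 S2 : {in E, S1 =1 S2} ->
  split_sum V E S1 = split_sum V E S2.
Proof.
move=> S12; have S12' : {in E, predC S1 =1 predC S2} by move=> x /S12 /= ->.
by rewrite /split_sum (eq_in_filter S12) (eq_in_filter S12').
Qed.

Lemma split_sum_linear V E S : linear_subspace V -> linear_subspace (split_sum V E S).
Proof.
move=> linV; apply/linear_subspaceP; split.
  exists 0, 0; split; [split|split|by rewrite addr0] => //; exact: subspace0.
move=> a _ _ [u1 [w1 [[Vu1 u10] [Vw1 w10] ->]]] [u2 [w2 [[Vu2 u20] [Vw2 w20] ->]]].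
exists (fun x => a * u1 x + u2 x), (fun x => a * w1 x + w2 x).
split; [split; first exact: subspaceDZ|split; first exact: subspaceDZ|].
- by move=> x xE; rewrite u10 ?u20 // mulr0 addr0.
- by move=> x xE; rewrite w10 ?w20 // mulr0 addr0.
by apply/funext => x; rewrite !fctE mulrDr addrACA.
Qed.

Lemma split_sum_sub V E S : linear_subspace V -> split_sum V E S `<=` V.
Proof. by move=> linV _ [u [w [[Vu _] [Vw _] ->]]]; apply: subspaceD. Qed.

(** f = (f - g)/2 + (f + g)/2, and at every point of E one of the two terms
    vanishes. *)
Lemma split_sum_diff V E f g : linear_subspace V -> V f -> V g ->
  (forall x, x \in E -> `|g x| = `|f x|) ->
  split_sum V E [pred x | g x == f x] f.
Proof.
move=> linV Vf Vg gf.
exists (fun x => 2^-1 * (f - g) x), (fun x => 2^-1 * (f + g) x).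
split; [split|split|].
- by apply: subspaceZ => //; apply: subspaceB.
- by move=> x; rewrite mem_filter /= => /andP[/eqP e _]; rewrite !fctE e subrr mulr0.
- by apply: subspaceZ => //; apply: subspaceD.
- move=> x; rewrite mem_filter /= => /andP[/eqP e /gf/eqP].
  by rewrite eqr_norm2 => /orP[/eqP//|/eqP h]; rewrite !fctE h subrr mulr0.
by apply/funext => x; rewrite !fctE; lra.
Qed.

(** The exceptional set is the union of the proper subspaces among the
    V_S + V_(E \ S), S ranging over the subsets of E.  The subsets are indexed
    by bit masks, and a sum which is all of V is replaced by the zero
    subspace. *)
Lemma almost_phaseless_of_connected V E : linear_subspace V ->
  (exists2 f, V f & f <> 0) ->
  (forall f, V f -> vanish E f -> f = 0) ->
  (forall S, V `<=` split_sum V E S ->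
     {in E, forall x, S x} \/ {in E, forall x, ~~ S x}) ->
  almost_phaseless_sampling V E.
Proof.
move=> linV [f1 Vf1 f1n0] V0 conn.
pose T := {: (size E).-tuple bool}.
pose WT (b : (size E).-tuple bool) := split_sum V E (mem (mask b E)).
pose W (i : 'I_#|T|) := if `[< WT (enum_val i) `<` V >] then WT (enum_val i) else [set 0].
exists (\bigcup_(i in [set: 'I_#|T|]) W i); split.
  exists #|T|, W; split=> // i; rewrite /W; case: asboolP => [?|_].
    by split=> //; apply: split_sum_linear.
  split.
    apply/linear_subspaceP; split=> // a _ _ -> ->.
    by apply/funext => x; rewrite mulr0 addr0.
  by split=> [_ ->|/(_ _ Vf1)//]; apply: subspace0.
move=> f [Vf fW] g Vg gf.
pose S := [pred x | g x == f x].
have szb : size (map S E) == size E by rewrite size_map.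
pose b : T := Tuple szb.
have WE : WT b = split_sum V E S.
  apply: eq_in_split_sum => x xE /=.
  by rewrite -filter_mask mem_filter xE andbT.
have fS : split_sum V E S f by apply: split_sum_diff.
have VS : V `<=` split_sum V E S.
  apply: contrapT => nVS; apply: fW; exists (enum_rank b) => //.
  rewrite /W enum_rankK WE; case: asboolP => // nlt; exfalso; apply: nlt.
  by split => //; exact: split_sum_sub.
have [hS|hS] := conn S VS; [left|right].
  apply/eqP; rewrite -subr_eq0; apply/eqP/V0; first exact: subspaceB.
  by move=> x /hS /eqP; rewrite !fctE => ->; rewrite subrr.
apply/eqP; rewrite -addr_eq0; apply/eqP/V0; first exact: subspaceD.
move=> x xE; have := gf x xE; have := hS x xE => /= /negbTE ne /eqP.
by rewrite eqr_norm2 ne /= !fctE => /eqP ->; rewrite addNr.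
Qed.

(** If f vanishes on E, then h, h + f and h + 2 f have the same moduli on E for
    every h; for a generic h the first one is equal to the others up to sign,
    which is only possible for f = 0. *)
Lemma almost_phaseless_inj V E f : linear_subspace V ->
  almost_phaseless_sampling V E -> V f -> vanish E f -> f = 0.
Proof.
move=> linV [_ [[k [W [HW ->]]] ap]] Vf f0.
have [h Vh hW] := avoid_subspaces linV HW.
have hdet : determined_up_to_sign V E h by apply: ap; split=> // -[i _ /hW].
have det (a : R) : 0 < a -> (fun x => a * f x) = 0 \/ (fun x => a * f x) = (fun x => - 2 * h x).
  move=> a0; have [||e|e] := hdet (fun x => a * f x + h x).
  - exact: subspaceDZ.
  - by move=> x /f0 ->; rewrite mulr0 add0r.
  - left; apply/funext => x; change (a * f x = 0).
    have ex : a * f x + h x = h x := congr1 (@^~ x) e; lra.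
  - right; apply/funext => x.
    have ex : a * f x + h x = - h x := congr1 (@^~ x) e; lra.
have [//|e1|e1] := det 1.
  by apply/funext => x; rewrite -[f x]mul1r; exact: (congr1 (@^~ x) e1).
apply/funext => x; change (f x = 0).
have ex1 : 1 * f x = - 2 * h x := congr1 (@^~ x) e1.
have [//|e2|e2] := det 2.
  by have ex2 : 2 * f x = 0 := congr1 (@^~ x) e2; lra.
by have ex2 : 2 * f x = - 2 * h x := congr1 (@^~ x) e2; lra.
Qed.

(** If both V_S and V_(E \ S) were nonzero, they would be proper subspaces, as
    they meet only in V_E = 0.  A generic f then is f1 + f2 with both terms
    nonzero, and f2 - f1 has the same moduli as f on E. *)
Lemma almost_phaseless_connected V E S u w : linear_subspace V ->
  almost_phaseless_sampling V E -> V `<=` split_sum V E S ->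
  V u -> vanish (seq.filter S E) u -> V w -> vanish (seq.filter (predC S) E) w ->
  u = 0 \/ w = 0.
Proof.
move=> linV ap VS Vu u0 Vw w0; have V0 := fun f => almost_phaseless_inj linV ap (f := f).
apply: contrapT => /not_orP[un0 wn0].
pose VV (T : pred R) : set (R -> R) := [set f | V f /\ vanish (seq.filter T E) f].
have linVV T : linear_subspace (VV T).
  apply/linear_subspaceP; split; first by split=> //; exact: subspace0.
  move=> a f g [Vf f0] [Vg g0]; split; first exact: subspaceDZ.
  by move=> x xE; rewrite f0 ?g0 // mulr0 addr0.
have vv f : vanish (seq.filter S E) f -> vanish (seq.filter (predC S) E) f -> vanish E f.
  move=> f1 f2 x xE; case Sx: (S x); [apply: f1|apply: f2];
  by rewrite mem_filter xE /= Sx.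
have [_ [[k [W [HW ->]]] det]] := ap.
pose W' (i : 'I_(2 + k)) := match fintype.split i with
  | inl j => if j == ord0 then VV S else VV (predC S)
  | inr j => W j end.
have [i|f Vf fW] := @avoid_subspaces V _ W' linV.
  rewrite /W'; case: (fintype.split i) => j; last exact: HW.
  case: ifP => _; split=> //; split=> [f []//|VV1].
    by apply: wn0; apply: V0 => //; apply: vv => //; have [] := VV1 _ Vw.
  by apply: un0; apply: V0 => //; apply: vv => //; have [] := VV1 _ Vu.
have fW1 j : ~ W j f by have := fW (rshift 2 j); rewrite /W' (unsplitK (inr _ j)).
have fS : ~ VV S f.
  by have := fW (lshift k (ord0 : 'I_2)); rewrite /W' (unsplitK (inl _ (ord0 : 'I_2))).
have fSC : ~ VV (predC S) f.
  by have := fW (lshift k (ord_max : 'I_2)); rewrite /W' (unsplitK (inl _ (ord_max : 'I_2))).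
have [f1 [f2 [[Vf1 f10] [Vf2 f20] fE]]] := VS _ Vf.
have [|||e|e] := det f _ (f2 - f1).
- by split=> // -[i _ /fW1].
- exact: subspaceB.
- move=> x xE; rewrite fE !fctE; case Sx: (S x).
    by rewrite f10 ?mem_filter ?Sx ?xE // subr0 add0r.
  by rewrite f20 ?mem_filter /= ?Sx ?xE // addr0 sub0r normrN.
- apply: fSC; split=> // x xE.
  have ex : f2 x - f1 x = f x := congr1 (@^~ x) e.
  by have : f x = f1 x + f2 x := congr1 (@^~ x) fE; rewrite f20 // in ex *; lra.
- apply: fS; split=> // x xE.
  have ex : f2 x - f1 x = - f x := congr1 (@^~ x) e.
  by have : f x = f1 x + f2 x := congr1 (@^~ x) fE; rewrite f10 // in ex *; lra.
Qed.

End Phaseless.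

(** * Splines on a bounded interval *)

Lemma intr_add_dist (R : realType) (N1 N2 : int) : N1 < N2 ->
  N2%:~R = N1%:~R + `|N2 - N1|%N%:R :> R.
Proof. by move=> N12; rewrite -[_%:R]/((_%:Z)%:~R) -intrD; congr _%:~R; lia. Qed.

Section Collocation.
Variables (R : realType) (m : nat).
Implicit Types x : R.

(** The coefficient sequence v placed at the indices r, ..., r + k - 1. *)
Definition block_coefs k (r : nat) (v : 'rV[R]_k) (i : nat) : R :=
  if (r <= i)%N then oapp (v 0) 0 (insub (i - r)%N) else 0.

Lemma block_coefsE k r (v : 'rV[R]_k) (i : 'I_k) : block_coefs r v (r + i) = v 0 i.
Proof. by rewrite /block_coefs leq_addr addKn valK. Qed.

Lemma block_coefs_out k r (v : 'rV[R]_k) i : ~~ (r <= i < r + k)%N ->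
  block_coefs r v i = 0.
Proof.
rewrite /block_coefs; case: (leqP r i) => //= ri ki.
have kir : ~~ (i - r < k)%N by lia.
by case: insubP => // j jk; case/negP: kir.
Qed.

Lemma spline_block k q r (v : 'rV[R]_k) x : (r + k <= q)%N ->
  spline m (block_coefs r v) 0 q x = spline m (block_coefs r v) r (r + k) x.
Proof.
move=> rkq; rewrite (@spline_cat _ _ _ _ r); last by lia.
rewrite (@spline_cat _ _ _ r (r + k)%N); last by lia.
have b0 i : ~~ (r <= i < r + k)%N -> block_coefs r v i = 0.
  exact: block_coefs_out.
rewrite [X in X + _ = _]spline_eq0 ?add0r; last by move=> i ir; apply: b0; lia.
by rewrite [X in _ + X = _]spline_eq0 ?addr0 // => i ir; apply: b0; lia.
Qed.

Definition collocation n k (r : nat) (t : 'I_n -> R) : 'M[R]_(k, n) :=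
  \matrix_(i, j) bspline m (t j - (r + i)%:R).

Lemma collocationE n k q r (t : 'I_n -> R) (v : 'rV_k) j : (r + k <= q)%N ->
  (v *m collocation k r t) 0 j = spline m (block_coefs r v) 0 q (t j).
Proof.
move=> rkq; rewrite spline_block // mxE /spline -[X in \sum_(X <= i < _) _]add0n.
rewrite big_addn addKn big_mkord; apply: eq_bigr => i _.
by rewrite mxE [(i + r)%N]addnC block_coefsE.
Qed.

End Collocation.

Section LocalSplines.
Variables (R : realType) (m : nat) (N1 N2 : int).
Hypotheses (m_gt0 : (0 < m)%N) (ltN12 : N1 < N2).
Implicit Types (x : R) (c : nat -> R) (e : nat -> R).

Definition dim := (`|N2 - N1| + m)%N.
(** In this coordinate the B-splines that do not vanish on [N1, N2] are the
    integer translates with indices 0, ..., dim - 1. *)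
Definition shift (x : R) : R := x - N1%:~R + m%:R.
Definition local_spline c : R -> R :=
  fun x => spline m c 0 dim (shift x) * \1_`[N1%:~R, N2%:~R] x.

Lemma local_spline_in c x : x \in `[N1%:~R, N2%:~R] ->
  local_spline c x = spline m c 0 dim (shift x).
Proof. by move=> xin; rewrite /local_spline indicE mem_set ?mulr1. Qed.

Lemma local_splineE (C : int -> R) x : x \in `[N1%:~R, N2%:~R] ->
  \sum_(n \in [set: int]) C n * bspline m (x - n%:~R) =
  spline m (fun i => C (N1 - m%:Z + i%:Z)) 0 dim (shift x).
Proof.
rewrite in_itv /= => /andP[x1 x2].
rewrite (fsbigE [seq N1 - m%:Z + i%:Z | i <- iota 0 dim]) //.
- rewrite big_map (eq_bigl xpredT); last by move=> i; rewrite in_setT.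
  rewrite /spline /index_iota subn0; apply: eq_bigr => i _.
  congr (_ * bspline m _); rewrite /shift !intrD rmorphN /= -!pmulrn; lra.
- by rewrite map_inj_uniq ?iota_uniq // => i j; lia.
move=> n _ nr; rewrite bspline_out ?mulr0 // subr_le0.
have [nN|nN] := ltP n (N1 - m%:Z).
  apply/orP; right; rewrite lerBrDl; apply: le_trans x1.
  have : n + m.+1%:Z <= N1 by lia.
  by rewrite -(ler_int R) intrD.
have [nN2|nN2] := leP N2 n.
  by apply/orP; left; apply: le_trans x2 _; rewrite ler_int.
exfalso; move/negP: nr; apply; apply/mapP; exists `|n - (N1 - m%:Z)%R|%N; last by lia.
by rewrite mem_iota /dim; lia.
Qed.

(** Only the coefficients with indices from N1 - m to N2 - 1 matter on
    [N1, N2]. *)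
Lemma spline_space_onP g :
  spline_space_on m N1 N2 g <-> exists c, g = local_spline c.
Proof.
split.
  move=> [_ [C ->] <-]; exists (fun i => C (N1 - m%:Z + i%:Z)).
  apply/funext => x; rewrite /local_spline /= indicE.
  have [/set_mem xin|_] := boolP (x \in _); last by rewrite !mulr0.
  by rewrite local_splineE.
move=> [c ->]; pose C (n : int) := c `|n - (N1 - m%:Z)%R|%N.
exists (fun x => \sum_(n \in [set: int]) C n * bspline m (x - n%:~R)); first by exists C.
apply/funext => x; rewrite /local_spline /= indicE.
have [/set_mem xin|_] := boolP (x \in _); last by rewrite !mulr0.
rewrite local_splineE //; congr (_ * _); apply: eq_bigr => i _.
rewrite /C; congr (c _ * _); lia.
Qed.

Lemma spline_lin a c1 c2 p q x : spline m (fun i => a * c1 i + c2 i) p q x =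
  a * spline m c1 p q x + spline m c2 p q x.
Proof.
rewrite /spline mulr_sumr -big_split; apply: eq_bigr => i _.
by rewrite mulrDl mulrA.
Qed.

Lemma local_spline_lin a c1 c2 : local_spline (fun i => a * c1 i + c2 i) =
  fun x => a * local_spline c1 x + local_spline c2 x.
Proof. by apply/funext => x; rewrite /local_spline spline_lin mulrDl mulrA. Qed.

Lemma local_spline_eq0 c : (forall i, (i < dim)%N -> c i = 0) -> local_spline c = 0.
Proof.
by move=> c0; apply/funext => x; rewrite /local_spline spline_eq0 ?mul0r.
Qed.

Lemma spline_space_on_linear : linear_subspace (spline_space_on m N1 N2 : set (R -> R)).
Proof.
apply/linear_subspaceP; split.
  by apply/spline_space_onP; exists (fun=> 0); rewrite local_spline_eq0.
move=> a u w /spline_space_onP[c1 ->] /spline_space_onP[c2 ->].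
by apply/spline_space_onP; rewrite -local_spline_lin; eexists.
Qed.

Lemma local_spline_nodes c e : nodes m 0 dim (shift \o e) ->
  (forall i, (i < dim)%N -> e i \in `[N1%:~R, N2%:~R]) ->
  (forall i, (i < dim)%N -> local_spline c (e i) = 0) ->
  forall i, (i < dim)%N -> c i = 0.
Proof.
move=> ne ein f0 i id; apply: (schoenberg_whitney m_gt0 ne _ (i := i)) => // j.
by move=> /andP[_ jd]; rewrite -[RHS](f0 j jd) local_spline_in //; exact: ein.
Qed.

Lemma dim_gt1 : (1 < dim)%N.
Proof. by rewrite /dim; lia. Qed.

(** Linear independence on [N1, N2]: equidistributed points of (N1, N2), one for
    each B-spline, satisfy the Schoenberg-Whitney condition. *)
Lemma local_spline_inj c : local_spline c = 0 -> forall i, (i < dim)%N -> c i = 0.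
Proof.
move=> f0; pose th i : R := `|N2 - N1|%N%:R * (i%:R + 2^-1) / dim%:R.
pose e i := N1%:~R + th i.
have d0 : 0 < dim%:R :> R by rewrite ltr0n; exact: ltnW dim_gt1.
have n0 : 1 <= `|N2 - N1|%N%:R :> R by rewrite (ler_nat _ 1); lia.
have k0 : 1 <= m%:R :> R by rewrite (ler_nat _ 1).
have dE : dim%:R = `|N2 - N1|%N%:R + m%:R :> R by rewrite natrD.
have lo i : (i < dim)%N -> i%:R < th i + m%:R.
  rewrite -(ler_nat R) -natr1 => id; rewrite -ltrBlDr ltr_pdivlMr // dE.
  have := ler_wpM2l (ltW (lt_le_trans ltr01 k0)) id; rewrite dE; nra.
have hi i : th i < i%:R + 1.
  by rewrite ltr_pdivrMr // dE; have := ler0n R i; nra.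
apply: (@local_spline_nodes c e).
- split=> i.
    move=> /andP[_ id]; rewrite /= /shift /e natrD -natr1.
    by have := lo i id; have := hi i; lra.
  move=> _ id; rewrite /= /shift /e ltrD2r ltrD2r ltrD2l.
  rewrite ltr_pM2r ?invr_gt0 // ltr_pM2l; last by lra.
  by rewrite ltrD2r ltr_nat.
- move=> i id; rewrite in_itv /= /e (intr_add_dist R ltN12) lerDl lerD2l.
  have i0 := ler0n R i; apply/andP; split.
    by rewrite /th divr_ge0 ?mulr_ge0 //; lra.
  have id' : i%:R + 2^-1 <= dim%:R :> R by move: id; rewrite -(ler_nat R) -natr1; lra.
  by rewrite ler_pdivrMr // ler_wpM2l //; lra.
by move=> i _; rewrite f0.
Qed.

(** There are fewer equations than unknowns. *)
Lemma exists_vanishing (s : seq R) : (size s < dim)%N ->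
  exists2 f, spline_space_on m N1 N2 f & f <> 0 /\ vanish s f.
Proof.
move=> sd; pose A := collocation m dim 0 (fun j : 'I_(size s) => shift (nth 0 s j)).
have : kermx A != 0.
  by rewrite -mxrank_eq0 mxrank_ker subn_eq0 -ltnNge (leq_ltn_trans (rank_leq_col A)).
move=> /rowV0Pn[v /sub_kermxP vA v0].
exists (local_spline (block_coefs 0 v)); first by apply/spline_space_onP; eexists.
split.
  move=> /local_spline_inj v00; case/eqP: v0; apply/rowP => i.
  by rewrite -(block_coefsE 0) mxE v00 // add0n.
move=> x xs; have xi : (index x s < size s)%N by rewrite index_mem.
have := collocationE m (fun j : 'I_(size s) => shift (nth 0 s j)) v (Ordinal xi)
  (leqnn (0 + dim)).
rewrite vA mxE /= nth_index //.
by rewrite /local_spline => <-; rewrite mul0r.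
Qed.

End LocalSplines.

(** * Sufficiency of the counting conditions *)

Lemma sorted_nth_count (R : realType) (s : seq R) (p : pred R) k :
  sorted <=%R s -> (forall x y, x <= y -> p y -> p x) -> (k < size s)%N ->
  p (nth 0 s k) = (k < count p s)%N.
Proof.
move=> + pdown; elim: s k => [//|x s IH] k /= ps ks.
have allx : p x = false -> count p s = 0%N.
  move=> px; apply/eqP; rewrite -leqn0 leqNgt -has_count; apply/negP => /hasP[y ys py].
  have /allP/(_ y ys) xy := order_path_min le_trans ps.
  by rewrite (pdown _ _ xy py) in px.
case: k ks => [|k] ks /=.
  by case px : (p x) => //=; rewrite allx.
rewrite IH ?(path_sorted ps) //.
case px : (p x) => //=.
by rewrite allx //.
Qed.

Lemma leq_count_add (T : eqType) (s : seq T) (p q r : pred T) :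
  {in s, forall x, p x -> r x && ~~ q x} -> {in s, forall x, q x -> r x} ->
  (count p s + count q s <= count r s)%N.
Proof.
elim: s => [//|x s IH] pr qr; rewrite /= addnACA leq_add //.
  move: (pr x (mem_head _ _)) (qr x (mem_head _ _)).
  by case: (p x) (q x) (r x) => [] [] [] // h1 h2; first [have := h1 isT|have := h2 isT].
by apply: IH => z zs; [apply: pr|apply: qr]; rewrite inE zs orbT.
Qed.

Section Sufficiency.
Variables (R : realType) (m : nat) (N1 N2 : int) (E : seq R).
Hypotheses (m_gt0 : (0 < m)%N) (ltN12 : N1 < N2) (uniqE : uniq E).
Hypothesis subE : forall x, x \in E -> x \in `[N1%:~R, N2%:~R].
Notation d := (dim m N1 N2).
Notation X := (shift m N1 : R -> R).
Notation V := (spline_space_on m N1 N2 : set (R -> R)).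

Lemma shift_ge x : x \in E -> m%:R <= X x.
Proof. by move=> /subE; rewrite in_itv /= /shift => /andP[? _]; lra. Qed.

Lemma shift_le x : x \in E -> X x <= d%:R.
Proof.
move=> /subE; rewrite in_itv /= /shift (intr_add_dist R ltN12) natrD => /andP[_ ?]; lra.
Qed.

Section Exchange.
Variable S : pred R.
Hypothesis VS : V `<=` split_sum V E S.

(** Take f <> 0 in V vanishing at the common nodes; it does not vanish at e a.
    Write f = u + w along S.  If S (e a) held but not S (e' a), then w would
    vanish at all nodes of e', so w = 0, and f = u would vanish at e a. *)
Lemma swap_node (e e' : nat -> R) a : (a < d)%N ->
  nodes m 0 d (X \o e) -> nodes m 0 d (X \o e') ->
  (forall i, (i < d)%N -> e i \in E) -> (forall i, (i < d)%N -> e' i \in E) ->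
  (forall i, (i < d)%N -> i != a -> e' i = e i) ->
  S (e a) -> S (e' a).
Proof.
move=> ad ne ne' eE e'E ee' Sea; apply: contraT => nSe'a.
pose s := [seq e i | i <- seq.rem a (iota 0 d)].
have sz : (size s < d)%N.
  rewrite size_map size_rem ?mem_iota // size_iota.
  by have := dim_gt1 m_gt0 ltN12; lia.
have [f Vf [fn0 fs]] := exists_vanishing m_gt0 ltN12 sz.
have f0 i : (i < d)%N -> i != a -> f (e i) = 0.
  move=> id ia; apply: fs; apply/mapP; exists i => //.
  by rewrite mem_rem_uniq ?iota_uniq // inE ia mem_iota.
have [u [w [[Vu u0] [Vw w0] fE]]] := VS Vf.
have fux x : f x = u x + w x by rewrite fE.
have [c fc] := (spline_space_onP m_gt0 ltN12 f).1 Vf.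
have [b wb] := (spline_space_onP m_gt0 ltN12 w).1 Vw.
have w_e' i : (i < d)%N -> w (e' i) = 0.
  move=> id; have [->|ia] := eqVneq i a.
    by apply: w0; rewrite mem_filter /= nSe'a e'E.
  have e'iE := e'E i id.
  case Se : (S (e' i)); last by apply: w0; rewrite mem_filter /= Se.
  have := fux (e' i); rewrite u0 ?mem_filter ?Se // add0r => <-.
  by rewrite ee' // f0.
have w00 : w = 0.
  rewrite wb; apply: local_spline_eq0 => i id.
  apply: (local_spline_nodes m_gt0 ne' _ _ id) => j jd; first exact/subE/e'E.
  by rewrite -wb w_e'.
case: fn0; rewrite fc; apply: local_spline_eq0 => i id.
apply: (local_spline_nodes m_gt0 ne _ _ id) => j jd; first exact/subE/eE.
rewrite -fc; have [->|ja] := eqVneq j a; last exact: f0.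
by rewrite fux w00 u0 ?mem_filter ?Sea ?eE // addr0.
Qed.

(** In the rest of the section, any d of the d + 1 points y satisfy the
    Schoenberg-Whitney condition: y j lies in the windows of both the B-splines
    j - 1 and j. *)
Variable y : nat -> R.
Hypothesis yE : forall j, (j <= d)%N -> y j \in E.
Hypothesis y_mono : forall j, (j < d)%N -> y j < y j.+1.
Hypothesis y_lo : forall j, (j < d)%N -> j%:R < X (y j).
Hypothesis y_hi : forall j, (0 < j <= d)%N -> X (y j) < (j + m)%:R.

(* The sequence y without y a.+1, which is why x may come next to y a below. *)
Let skip a i := y (i + (a < i)).

Lemma X_lt : {mono X : x y / x < y}.
Proof. by move=> x z; rewrite /shift !ltrD2r. Qed.

Let y_lt i j : (i < j)%N -> (j <= d)%N -> y i < y j.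
Proof.
elim: j => // j IH; rewrite ltnS leq_eqVlt => /predU1P[->|ij] jd; first exact: y_mono.
by apply: lt_trans (IH ij (ltnW jd)) (y_mono jd).
Qed.

Lemma skip_nodes a : nodes m 0 d (X \o skip a).
Proof.
split=> [i /andP[_ id]|i _ id]; last first.
  by rewrite /= X_lt /skip; apply: y_lt; case: (ltnP a i); case: (ltnP a i.+1); lia.
have hi : X (y i.+1) < (i + m.+1)%:R.
  by rewrite addnS -addSn; apply: y_hi; lia.
have lo := y_lo id; have := y_mono id; rewrite -X_lt => lt.
rewrite /= /skip; case: ltnP => _; rewrite ?addn0 ?addn1; apply/andP; split=> //.
  exact: lt_trans lt.
exact: lt_trans hi.
Qed.

Lemma skip_E a i : (i < d)%N -> skip a i \in E.
Proof. by move=> id; apply: yE; case: ltnP => _; lia. Qed.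

(** Both y a and x complete the points y j, with j different from a and a.+1, to
    a Schoenberg-Whitney sequence. *)
Lemma exchange a x : (a < d)%N -> x \in E -> a%:R < X x < (a + m.+1)%:R ->
  ((0 < a)%N -> y a.-1 < x) -> ((a.+1 < d)%N -> x < y a.+2) -> S x = S (y a).
Proof.
move=> ad xE xin xlo xhi.
pose e i := if i == a then x else skip a i.
have ea : e a = x by rewrite /e eqxx.
have sa : skip a a = y a by rewrite /skip ltnn addn0.
have [sk_in sk_mono] := skip_nodes a.
have ne : nodes m 0 d (X \o e).
  split=> [i id|i _ id]; rewrite /= /e.
    by have [->//|_] := eqVneq i a; exact: sk_in.
  rewrite X_lt; have [ia|ia] := eqVneq i a.
    rewrite ifN ?ia; last by lia.
    by rewrite /skip ltnS leqnn addn1; apply: xhi; lia.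
  have [ia'|_] := eqVneq i.+1 a; last by rewrite -X_lt; exact: sk_mono.
  rewrite /skip ltnNge (_ : (i <= a)%N) ?addn0; last by lia.
  by have := xlo; rewrite -ia' => /(_ isT).
have eE i : (i < d)%N -> e i \in E.
  by move=> id; rewrite /e; case: eqP => _ //; exact: skip_E.
have ee i : (i < d)%N -> i != a -> e i = skip a i by move=> _ /negbTE ia; rewrite /e ia.
rewrite -ea -sa; apply/idP/idP.
  by apply: (swap_node ad ne (skip_nodes a) eE (@skip_E a)) => i id ia; rewrite ee.
exact: (swap_node ad (skip_nodes a) ne (@skip_E a) eE).
Qed.

(** Every y a.+1 can be exchanged for y a, and every x in E for the last y a with
    a < d and y a <= x, or for y 0. *)
Lemma exchange_connected : {in E, forall x, S x} \/ {in E, forall x, ~~ S x}.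
Proof.
have d1 := dim_gt1 m_gt0 ltN12.
have Sy j : (j <= d)%N -> S (y j) = S (y 0).
  elim: j => // j IH jd; rewrite -IH ?(ltnW jd) //.
  apply: exchange; rewrite ?yE //.
  - apply/andP; split; last by rewrite addnS -addSn; apply: y_hi; lia.
    by apply: lt_trans (y_lo jd) _; rewrite X_lt y_mono.
  - by move=> j0; apply: y_lt; lia.
  - by move=> j0; apply: y_lt; lia.
suff Sx x : x \in E -> S x = S (y 0).
  by case Sy0 : (S (y 0)); [left|right] => x /Sx ->; rewrite Sy0.
move=> xE; pose P a := (a < d)%N && ((a == 0%N) || (y a <= x)).
have exP : exists a, P a by exists 0%N; rewrite /P /=; lia.
have ubP a : P a -> (a <= d)%N by move=> /andP[/ltnW].
case: (ex_maxnP exP ubP) => a /andP[ad ya] amax.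
rewrite -(Sy a) ?(ltnW ad) //.
have next : (a.+1 < d)%N -> x < y a.+1.
  move=> a1; rewrite ltNge; apply/negP => yx.
  by have := amax a.+1; rewrite /P a1 yx orbT ltnn => /(_ isT).
apply: exchange => //; first (apply/andP; split).
- case/orP: ya => [/eqP->|yax].
    by apply: lt_le_trans (shift_ge xE); rewrite ltr0n.
  by apply: lt_le_trans (y_lo ad) _; rewrite lerD2r lerD2r.
- have [ad1|ad1] := ltnP a.+1 d.
    apply: lt_trans (_ : X x < X (y a.+1)) _; first by rewrite X_lt next.
    by rewrite addnS -addSn; apply: y_hi; lia.
  by apply: le_lt_trans (shift_le xE) _; rewrite ltr_nat; lia.
- case/orP: ya => [/eqP->//|yax] a0.
  by apply: lt_le_trans yax; apply: y_lt; lia.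
by move=> ad1; apply: lt_trans (next ad1) (y_mono _).
Qed.

Lemma vanish_E_eq0 f : V f -> vanish E f -> f = 0.
Proof.
move=> /(spline_space_onP m_gt0 ltN12)[c ->] f0.
apply: local_spline_eq0 => i id.
apply: (local_spline_nodes m_gt0 (skip_nodes 0) _ _ id) => j jd.
  exact/subE/skip_E.
by rewrite f0 // skip_E.
Qed.

End Exchange.

(** Greedy selection: y j is the first point of E beyond y (j - 1) and, if j < d,
    beyond j.
    Its rank in E is the maximum, over the last index i <= j at which the bound
    X x > i was active, of the number of points up to i plus j - i; the
    hypothesis says that this rank is small enough. *)
Lemma select_nodes :
  (forall i j, (i <= j)%N -> (0 < j <= d)%N -> (i < d)%N ->
    (count (fun x => (X x <= i%:R)%R) E + (j - i) < count (fun x => (X x < (j + m)%:R)%R) E)%N) ->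
  exists y : nat -> R,
    [/\ forall j, (j <= d)%N -> y j \in E, forall j, (j < d)%N -> y j < y j.+1,
        forall j, (j < d)%N -> j%:R < X (y j)
      & forall j, (0 < j <= d)%N -> X (y j) < (j + m)%:R].
Proof.
move=> hall; have d1 := dim_gt1 m_gt0 ltN12.
pose es := sort <=%R E.
have es_le : sorted <=%R es := sort_le_sorted E.
have es_lt : sorted <%R es by rewrite sort_lt_sorted.
have cntE p : count p es = count p E by apply/permP; rewrite perm_sort.
pose lo i := count (fun x => X x <= i%:R) E.
pose idx j := \max_(i < j.+1 | (i < d)%N) (lo i + (j - i))%N.
have idx_ge i j : (i <= j)%N -> (i < d)%N -> (lo i + (j - i) <= idx j)%N.
  move=> ij id; rewrite -ltnS in ij.
  exact: (@leq_bigmax_cond _ (fun i : 'I_j.+1 => (i < d)%N)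
    (fun i : 'I_j.+1 => (lo i + (j - i))%N) (Ordinal ij)).
have idx_lt j k : (0 < k)%N ->
    (forall i, (i <= j)%N -> (i < d)%N -> (lo i + (j - i) < k)%N) -> (idx j < k)%N.
  move=> k0 h; rewrite -(prednK k0) ltnS; apply/bigmax_leqP => i id.
  by have := h i (ltn_ord i) id; lia.
have idx_mono j : (idx j < idx j.+1)%N.
  apply: idx_lt => [|i ij id].
    by apply: leq_trans (idx_ge 0%N _ _ _) => //; lia.
  by apply: leq_trans (idx_ge i _ _ _) => //; lia.
have idx_hi j : (0 < j <= d)%N -> (idx j < count (fun x => (X x < (j + m)%:R)%R) E)%N.
  move=> jd; apply: idx_lt => [|i ij id]; last exact: hall.
  by apply: leq_ltn_trans (hall 0%N j _ _ _) => //; lia.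
have idx_sz j : (j <= d)%N -> (idx j < size es)%N.
  rewrite size_sort; case: j => [|j] jd.
    apply: ltn_trans (idx_mono 0%N) _.
    by apply: leq_trans (idx_hi 1%N _) (count_size _ _); lia.
  by apply: leq_trans (idx_hi j.+1 _) (count_size _ _); lia.
have X_le x z : x <= z -> X x <= X z by rewrite /shift; lra.
exists (fun j => nth 0 es (idx j)); split=> j jd.
- by rewrite -(mem_sort <=%R); apply: mem_nth; exact: idx_sz.
- by rewrite lt_sorted_ltn_nth ?inE ?idx_sz // ltnW.
- rewrite ltNge (@sorted_nth_count R es (fun x => X x <= j%:R)) //.
  + by rewrite cntE -leqNgt; have := idx_ge j j (leqnn j) jd; rewrite subnn addn0.
  + by move=> x z /X_le; exact: le_trans.
  + exact/idx_sz/ltnW.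
rewrite (@sorted_nth_count R es (fun x => X x < (j + m)%:R)) //.
- by rewrite cntE idx_hi.
- by move=> x z /X_le; exact: le_lt_trans.
by apply: idx_sz; lia.
Qed.

Hypothesis size_hyp : N2 - N1 + m%:Z + 1 <= (size E)%:Z.
Hypothesis left_hyp : forall k : int, 1 <= k <= N2 - N1 ->
  k + 1 <= (count (fun x => x \in `[N1%:~R, (N1 + k)%:~R[) E)%:Z.
Hypothesis right_hyp : forall k : int, 1 <= k <= N2 - N1 ->
  k + 1 <= (count (fun x => x \in `](N2 - k)%:~R, N2%:~R]) E)%:Z.
Hypothesis inner_hyp : forall n1 n2 : int, N1 <= n1 -> n1 < n2 -> n2 <= N2 ->
  n2 - n1 - m%:Z + 1 <= (count (fun x => x \in `]n1%:~R, n2%:~R[) E)%:Z.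

(** The points beyond i and before j + m are those counted by the left, inner,
    size or right condition, according to whether the left bound i lies before
    N1 (that is, i < m) and whether the right bound lies beyond N2 (that is,
    j > N2 - N1). *)
Lemma hall_condition i j : (i <= j)%N -> (0 < j <= d)%N -> (i < d)%N ->
  (count (fun x => (X x <= i%:R)%R) E + (j - i)
     < count (fun x => (X x < (j + m)%:R)%R) E)%N.
Proof.
move=> ij /andP[j0 jd] id.
have N12 := ltN12; have m0 := m_gt0; have dE : d = (`|N2 - N1| + m)%N by [].
have XE x : X x = x - N1%:~R + m%:R by [].
have jE : (N1 + j%:Z)%:~R = N1%:~R + j%:R :> R by rewrite intrD -pmulrn.
suff [B [cB pB qB]] : exists B : pred R, [/\ (j - i < count B E)%N,
    {in E, forall x, X x <= i%:R -> ~~ B x} & {in E, forall x, B x -> X x < (j + m)%:R}].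
  apply: (@leq_trans (count (fun x => (X x <= i%:R)%R) E + count B E)%N).
    by rewrite ltn_add2l.
  apply: leq_count_add => // x xE xi; rewrite pB // andbT.
  by apply: le_lt_trans xi _; rewrite ltr_nat; lia.
have left_out : (i < m)%N -> {in E, forall x, ~ X x <= i%:R}.
  move=> im x /shift_ge xm; apply/negP; rewrite -ltNge.
  by apply: lt_le_trans xm; rewrite ltr_nat.
have [jN|jN] := leqP j `|N2 - N1|%N.
  have [im|im] := ltnP i m.
    exists (fun x => x \in `[N1%:~R, (N1 + j%:Z)%:~R[); split.
    - by rewrite -ltz_nat; apply: lt_le_trans (left_hyp _); lia.
    - by move=> x xE /(left_out im x xE).
    - by move=> x xE; rewrite in_itv /= jE natrD XE => /andP[_]; lra.
  have iE : (N1 + (i - m)%N%:Z)%:~R = N1%:~R + (i%:R - m%:R) :> R.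
    by rewrite intrD -pmulrn natrB.
  exists (fun x => x \in `](N1 + (i - m)%N%:Z)%:~R, (N1 + j%:Z)%:~R[); split.
  - by rewrite -ltz_nat; apply: lt_le_trans (inner_hyp _ _ _); lia.
  - move=> x xE; rewrite in_itv /= iE XE => xi; rewrite negb_and -leNgt; apply/orP; left; lra.
  - by move=> x xE; rewrite in_itv /= jE natrD XE => /andP[_]; lra.
have all_lt : {in E, forall x, X x < (j + m)%:R}.
  by move=> x /shift_le xd; apply: le_lt_trans xd _; rewrite ltr_nat; lia.
have [im|im] := ltnP i m.
  exists predT; split.
  - by rewrite count_predT; have := size_hyp; lia.
  - by move=> x xE /(left_out im x xE).
  - by move=> x xE _; exact: all_lt.
have iE : (N2 - (d - i)%N%:Z)%:~R = N1%:~R + (i%:R - m%:R) :> R.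
  by rewrite -(natrB R im) -[(i - m)%:R]/((i - m)%N%:Z%:~R) -intrD; congr _%:~R; lia.
exists (fun x => x \in `](N2 - (d - i)%N%:Z)%:~R, N2%:~R]); split.
- by rewrite -ltz_nat; apply: lt_le_trans (right_hyp _); lia.
- move=> x xE; rewrite in_itv /= iE XE => xi; rewrite negb_and -leNgt; apply/orP; left; lra.
- by move=> x xE _; exact: all_lt.
Qed.

Lemma sufficiency : almost_phaseless_sampling V E.
Proof.
have [y [yE y_mono y_lo y_hi]] := select_nodes hall_condition.
apply: almost_phaseless_of_connected.
- exact: spline_space_on_linear.
- have [f Vf [f0 _]] := @exists_vanishing R m N1 N2 m_gt0 ltN12 [::] (ltnW (dim_gt1 m_gt0 ltN12)).
  by exists f.
- exact: vanish_E_eq0 yE y_mono y_lo y_hi.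
- by move=> S VS; apply: exchange_connected VS y yE y_mono y_lo y_hi.
Qed.

End Sufficiency.

(** * Necessity of the counting conditions *)

Section Necessity.
Variables (R : realType) (m : nat) (N1 N2 : int) (E : seq R).
Hypotheses (m_gt0 : (0 < m)%N) (ltN12 : N1 < N2) (uniqE : uniq E).
Hypothesis subE : forall x, x \in E -> x \in `[N1%:~R, N2%:~R].
Notation d := (dim m N1 N2).
Notation X := (shift m N1 : R -> R).
Notation V := (spline_space_on m N1 N2 : set (R -> R)).
Hypothesis ap : almost_phaseless_sampling V E.

Let linV : linear_subspace V := spline_space_on_linear R m_gt0 ltN12.

Let V_inj f : V f -> vanish E f -> f = 0 := almost_phaseless_inj linV ap (f := f).

(** With V_E = 0 and only d points, each point e splits off: some spline vanishes
    on E except at e, and subtracting a multiple of it moves any f into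
    V_({e}). *)
Lemma size_gt : (d < size E)%N.
Proof.
have d1 := dim_gt1 m_gt0 ltN12.
rewrite ltnNge; apply/negP => sE.
case: E sE uniqE subE V_inj ap => [|e E'] sE uE sub inj apE.
  have [f Vf [f0 _]] := exists_vanishing m_gt0 ltN12 (s := [::] : seq R) (ltnW d1).
  by apply: f0; apply: inj.
have /andP[eE' uE'] := uE.
have [u Vu [un0 u0]] := exists_vanishing m_gt0 ltN12 (s := [:: e]) d1.
have [w Vw [wn0 w0]] := exists_vanishing m_gt0 ltN12 (s := E') sE.
have we : w e != 0.
  apply/eqP => we; apply: wn0; apply: inj => // x.
  by rewrite inE => /predU1P[->//|]; exact: w0.
have fe : seq.filter (pred1 e) (e :: E') = [:: e].
  rewrite /= eqxx (_ : seq.filter _ _ = [::]) //.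
  by apply/eqP; rewrite -[_ == _]negbK -has_filter has_pred1.
have fE' : seq.filter (predC (pred1 e)) (e :: E') = E'.
  rewrite /= eqxx /=; apply/all_filterP/allP => x xE' /=.
  by apply: contraNneq eE' => <-.
have split_all : V `<=` split_sum V (e :: E') (pred1 e).
  move=> f Vf; exists (f - (fun x => (f e / w e) * w x)), (fun x => (f e / w e) * w x).
  rewrite fe fE'; split; last by rewrite subrK.
    split; first by apply: subspaceB => //; exact: subspaceZ.
    by move=> x; rewrite inE => /eqP ->; rewrite !fctE divfK // subrr.
  split; first exact: subspaceZ.
  by move=> x /w0 ->; rewrite mulr0.
have := almost_phaseless_connected linV apE split_all Vu _ Vw _.
by rewrite fe fE' => /(_ u0 w0) [].
Qed.

(** Let only the points of S see the k B-splines of the block.  As V_E = 0, a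
    combination of them is determined by its values on S; were there at most k
    such points, every f in V would agree on S with a combination w of the
    block, so that f = (f - w) + w would split along S. *)
Lemma block_count (S : pred R) r k : (0 < k < d)%N -> (r + k <= d)%N ->
  (forall c x, x \in E -> ~~ S x -> spline m c r (r + k) (X x) = 0) ->
  (k < count S E)%N.
Proof.
move=> /andP[k0 kd] rkd off; rewrite ltnNge; apply/negP => Sk.
pose s := seq.filter S E.
have sk : (size s <= k)%N by rewrite size_filter.
pose A := collocation m k r (fun j : 'I_(size s) => X (nth 0 s j)).
pose w (v : 'rV[R]_k) : R -> R := local_spline m N1 N2 (block_coefs r v).
have Vw v : V (w v) by apply/spline_space_onP => //; eexists.
have w_off v : vanish (seq.filter (predC S) E) (w v).
  move=> x; rewrite mem_filter => /andP[/= nSx xE].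
  by rewrite /w local_spline_in ?subE // spline_block // off.
have w_on v (j : 'I_(size s)) : w v (nth 0 s j) = (v *m A) 0 j.
  rewrite (collocationE _ _ _ _ rkd) /w local_spline_in //; apply: subE.
  by have := mem_nth 0 (ltn_ord j); rewrite mem_filter => /andP[].
have w_inj v : w v = 0 -> v = 0.
  move=> /(local_spline_inj m_gt0 ltN12) w0; apply/rowP => i.
  by rewrite -(block_coefsE r) w0 ?mxE //; have := ltn_ord i; lia.
have Afree : row_free A.
  apply/inj_row_free => v vA; apply: w_inj; apply: V_inj => // x xE.
  case Sx : (S x); last by apply: w_off; rewrite mem_filter /= Sx.
  have xs : x \in s by rewrite mem_filter Sx.
  have xi : (index x s < size s)%N by rewrite index_mem.
  by have := w_on v (Ordinal xi); rewrite /= nth_index // vA mxE.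
have sizes : size s = k.
  by apply/eqP; rewrite eqn_leq sk -(eqP Afree) rank_leq_col.
have Afull : row_full A by rewrite /row_full (eqP Afree) sizes.
have split_all : V `<=` split_sum V E S.
  move=> f Vf; pose b := \row_(j < size s) f (nth 0 s j).
  have /submxP[v bE] : (b <= A)%MS by apply: submx_full.
  exists (f - w v), (w v); split; last by rewrite subrK.
    split; first exact: subspaceB.
    move=> x xs; have xi : (index x s < size s)%N by rewrite index_mem.
    have := w_on v (Ordinal xi); rewrite -bE mxE /= nth_index // !fctE => ->.
    by rewrite subrr.
  by split.
have [u Vu [un0 u0]] := exists_vanishing m_gt0 ltN12 (leq_ltn_trans sk kd).
have := almost_phaseless_connected linV ap split_all Vu u0 (Vw (const_mx 1)) (w_off _).
case=> // /w_inj /rowP/(_ (Ordinal k0)); rewrite !mxE => /eqP.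
by rewrite oner_eq0.
Qed.

(** If E has no point in the window (r, r + m), no point of E sees both a B-spline
    of index less than r and one of index at least r, and V splits. *)
Lemma gap_count r : (0 < r < d)%N -> (0 < count (fun x => (r%:R < X x < (r + m)%:R)%R) E)%N.
Proof.
move=> /andP[r0 rd]; rewrite -has_count; apply: contraT => /hasPn gap.
pose S x := X x <= r%:R.
pose cl (c : nat -> R) i := if (i < r)%N then c i else 0.
pose cr (c : nat -> R) i := if (i < r)%N then 0 else c i.
have clE c x : spline m (cl c) 0 d x = spline m c 0 r x.
  rewrite (@spline_cat _ _ _ _ r) ?(ltnW rd) // [X in _ + X]spline_eq0 ?addr0.
    by apply: eq_big_nat => i /andP[_ ir]; rewrite /cl ir.
  by move=> i /andP[ri _]; rewrite /cl ltnNge ri.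
have crE c x : spline m (cr c) 0 d x = spline m c r d x.
  rewrite (@spline_cat _ _ _ _ r) ?(ltnW rd) // [X in X + _]spline_eq0 ?add0r.
    by apply: eq_big_nat => i /andP[ri _]; rewrite /cr ltnNge ri.
  by move=> i /andP[_ ir]; rewrite /cr ir.
pose u c := local_spline m N1 N2 (cr c) : R -> R.
pose w c := local_spline m N1 N2 (cl c) : R -> R.
have Vl c : V (local_spline m N1 N2 c) by apply/spline_space_onP => //; eexists.
have u0 c : vanish (seq.filter S E) (u c).
  move=> x; rewrite mem_filter => /andP[Sx xE].
  by rewrite /u local_spline_in ?subE // crE spline_before.
have w0 c : vanish (seq.filter (predC S) E) (w c).
  move=> x; rewrite mem_filter => /andP[/= Sx xE].
  rewrite /w local_spline_in ?subE // clE spline_after // leNgt.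
  apply/negP => xr; have := gap x xE; rewrite xr andbT => /negP; apply.
  by rewrite ltNge.
have split_all : V `<=` split_sum V E S.
  move=> f /(spline_space_onP m_gt0 ltN12)[c ->]; exists (u c), (w c).
  split; try by split=> //; exact: Vl.
  apply/funext => x; rewrite !fctE /u /w /local_spline -mulrDl crE clE addrC.
  by rewrite -spline_cat //; exact: ltnW.
have := almost_phaseless_connected linV ap split_all (Vl _) (u0 (fun=> 1)) (Vl _) (w0 (fun=> 1)).
case=> /(local_spline_inj m_gt0 ltN12) c0.
  by have /eqP := c0 r rd; rewrite /cr ltnn oner_eq0.
by have /eqP := c0 0%N (ltn_trans r0 rd); rewrite /cl r0 oner_eq0.
Qed.

Lemma necessity :
  [/\ N2 - N1 + m%:Z + 1 <= (size E)%:Z,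
      forall k : int, 1 <= k <= N2 - N1 ->
        k + 1 <= (count (fun x => x \in `[N1%:~R, (N1 + k)%:~R[) E)%:Z,
      forall k : int, 1 <= k <= N2 - N1 ->
        k + 1 <= (count (fun x => x \in `](N2 - k)%:~R, N2%:~R]) E)%:Z
    & forall n1 n2 : int, N1 <= n1 -> n1 < n2 -> n2 <= N2 ->
        n2 - n1 - m%:Z + 1 <=
          (count (fun x => x \in `]n1%:~R, n2%:~R[) E)%:Z].
Proof.
have dE : d = (`|N2 - N1| + m)%N by [].
have XE x : X x = x - N1%:~R + m%:R by [].
have N2E := intr_add_dist R ltN12.
have natE (n : nat) : n%:Z%:~R = n%:R :> R by [].
split.
- by have := size_gt; rewrite dE; have := ltN12; lia.
- move=> k kN; have [kn kE] : exists kn : nat, k = kn%:Z by exists `|k|%N; lia.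
  rewrite kE in kN *; rewrite lezD1 ltz_nat.
  apply: (@block_count _ 0); [have := ltN12; have := m_gt0; lia..|].
  move=> c x /[dup] xE /subE; rewrite !in_itv /= intrD natE => /andP[-> _].
  rewrite /= -leNgt => kx; apply: spline_after => //; rewrite XE add0n natrD; lra.
- move=> k kN; have [kn kE] : exists kn : nat, k = kn%:Z by exists `|k|%N; lia.
  rewrite kE in kN *; rewrite lezD1 ltz_nat.
  apply: (@block_count _ (d - kn)); [have := ltN12; have := m_gt0; lia..|].
  move=> c x /[dup] xE /subE; rewrite !in_itv /= intrD rmorphN /= natE => /andP[_ ->].
  rewrite andbT -leNgt => kx; apply: spline_before => //.
  rewrite XE natrB; last by have := ltN12; lia.
  by move: kx; rewrite N2E dE natrD; lra.
move=> n1 n2 n1N n12 n2N.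
(* For n2 - n1 = m + k, the block consists of the k B-splines supported in
   [n1, n2]; for k = 0 the gap lemma takes over. *)
have [np|np] := ltP (n2 - n1) m%:Z; first by lia.
have [r rE] : exists r : nat, n1 = N1 + r%:Z - m%:Z by exists `|(n1 - N1 + m%:Z)%R|%N; lia.
have n1E : n1%:~R = N1%:~R + r%:R - m%:R :> R by rewrite rE !intrD rmorphN /= !natE.
have [k kE] : exists k : nat, n2 = n1 + m%:Z + k%:Z by exists `|(n2 - n1 - m%:Z)%R|%N; lia.
have n2E : n2%:~R = N1%:~R + r%:R + k%:R :> R by rewrite kE !intrD n1E !natE; lra.
have -> : n2 - n1 - m%:Z + 1 = k.+1%:Z by lia.
have inE x : (x \in `]n1%:~R, n2%:~R[) = (r%:R < X x < (r + k + m)%:R).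
  rewrite in_itv /= n1E n2E XE !natrD; apply/idP/idP => /andP[? ?]; apply/andP; split; lra.
rewrite (eq_count inE) lez_nat.
case: k kE n2E inE => [|k] kE n2E inE.
  under eq_count do rewrite addn0.
  by apply: gap_count; have := ltN12; have := m_gt0; lia.
apply: (@block_count _ r); [have := ltN12; have := m_gt0; lia..|].
move=> c x xE; rewrite negb_and -!leNgt => /orP[].
  exact: spline_before.
exact: spline_after.
Qed.

End Necessity.

(** * The characterization *)

Local Close Scope classical_set_scope.

Theorem theorem2p2 (R : realType) (m : nat) (N1 N2 : int) (E : seq R)
    (m_ge1 : (1 <= m)%N) (ltN12 : N1 < N2) (uniqE : uniq E)
    (subE : forall x, x \in E -> x \in `[N1%:~R, N2%:~R]) :
  almost_phaseless_sampling (spline_space_on m N1 N2) E <->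
  [/\ N2 - N1 + m%:Z + 1 <= (size E)%:Z,
      forall k : int, 1 <= k <= N2 - N1 ->
        k + 1 <= (count (fun x => x \in `[N1%:~R, (N1 + k)%:~R[) E)%:Z,
      forall k : int, 1 <= k <= N2 - N1 ->
        k + 1 <= (count (fun x => x \in `](N2 - k)%:~R, N2%:~R]) E)%:Z
    & forall n1 n2 : int, N1 <= n1 -> n1 < n2 -> n2 <= N2 ->
        n2 - n1 - m%:Z + 1 <=
          (count (fun x => x \in `]n1%:~R, n2%:~R[) E)%:Z].
Proof.
split=> [ap|[size_hyp left_hyp right_hyp inner_hyp]].
  exact: necessity m_ge1 ltN12 uniqE subE ap.
exact: sufficiency m_ge1 ltN12 uniqE subE size_hyp left_hyp right_hyp inner_hyp.
Qed.
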